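(* Let $q_{n,\mathbf{m}} := \frac{\prod_{i=1}^n m_i}{\max_{i} m_i}$. Then $$\lim_{q_{n,\mathbf{m}}\to\infty}\Pr\left[\text{the clockwork best-response dynamic on } G_{n,\mathbf{m}} \text{ converges to a PNE}\right]=0,$$ i.e. for every $\varepsilon>0$ there is $Q$ such that for all $n\ge 2$ and all $\mathbf{m}=(m_1,\dots,m_n)$ with $m_i\ge 2$ and $q_{n,\mathbf{m}}\ge Q$, this probability is less than $\varepsilon$.
   Context: A random game $G_{n,\mathbf{m}}$ has $n\ge 2$ players; player $i$ has action set $[m_i]=\{1,\dots,m_i\}$ with $m_i\ge 2$; $\mathcal{M}=\times_{i=1}^n[m_i]$. For each player $i$ and profile $\mathbf{a}\in\mathcal{M}$ the payoff $U_i(\mathbf{a})$ is drawn from a fixed atomless probability distribution on $\mathbb{R}$, independently across all $i$ and $\mathbf{a}$. For an environment $\mathbf{a}_{-i}\in\times_{j\neq i}[m_j]$, the best response $B_i(\mathbf{a}_{-i})=\arg\max_{x\in[m_i]}U_i(x,\mathbf{a}_{-i})$ is almost surely unique. A pure Nash equilibrium (PNE) is a profile $\mathbf{a}$ with $a_i=B_i(\mathbf{a}_{-i})$ for all $i$. The clockwork playing sequence is $s_{\texttt{c}}(t)=1+((t-1)\bmod n)$, $t\in\mathbb{N}=\{1,2,\dots\}$. The clockwork best-response dynamic: draw $\mathbf{A}^0$ uniformly from $\mathcal{M}$ (independently of payoffs); for each $t\ge1$, with $i=s_{\texttt{c}}(t)$, set $A^t_j=A^{t-1}_j$ for $j\ne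 i$ and $A^t_i=B_i(\mathbf{A}^{t-1}_{-i})$. The dynamic converges to a PNE if there is a finite $t\ge 1$ such that $\mathbf{A}^t$ is a PNE of $G_{n,\mathbf{m}}$. *)

(* Defs.v *)
From HB Require Import structures.
From mathcomp Require Import all_boot all_order all_algebra.
From mathcomp Require Import all_classical all_reals all_analysis.
Set Implicit Arguments. Unset Strict Implicit. Unset Printing Implicit Defensive.
Import Order.TTheory GRing.Theory Num.Theory.
Local Open Scope ring_scope.

Definition profile (n : nat) (m : 'I_n -> nat) : finType :=
  {dffun forall i : 'I_n, 'I_(m i)}.

Section Game.
Variables (R : realType) (n : nat) (m : 'I_n -> nat).

Definition upd (a : profile m) (i : 'I_n) (x : 'I_(m i)) : profile m :=
  @finfun _ (fun j => 'I_(m j)) (@dfwith _ (fun j => 'I_(m j)) (fun k => a k) i x).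

(* Best response of player i to the environment a_{-i}, for payoffs u:
   an argmax over x of u i (x, a_{-i}) (ties, which have probability 0,
   are broken by Order.arg_max). *)
Definition br (u : 'I_n -> profile m -> R) (i : 'I_n) (a : profile m)
  : 'I_(m i) :=
  Order.arg_max (a i) xpredT (fun x : 'I_(m i) => u i (@upd a i x)).

Definition isPNE (u : 'I_n -> profile m -> R) (a : profile m) : Prop :=
  forall i : 'I_n, a i = br u i a.

(* One step of the dynamic at time t = k+1: the player s_c(k+1) = 1 + (k mod n)
   (0-based: k %% n) best-responds. *)
Definition clock_step (u : 'I_n -> profile m -> R) (k : nat) (a : profile m)
  : profile m :=
  if @insub nat (fun j => (j < n)%N) 'I_n (k %% n)%N is Some i
  then @upd a i (br u i a) else a.

Definition clockwork (u : 'I_n -> profile m -> R) (a0 : profile m) (t : nat)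
  : profile m := iteri t (clock_step u) a0.

Definition converges (u : 'I_n -> profile m -> R) (a0 : profile m) : Prop :=
  exists t : nat, (1 <= t)%N /\ isPNE u (clockwork u a0 t).

Definition qnm : R :=
  (\prod_(i < n) (m i)%:R) / (\max_(i < n) m i)%:R.

End Game.

(* Main.v *)
Require Import Defs.
From HB Require Import structures.
From mathcomp Require Import all_boot all_order all_algebra fingroup perm.
From mathcomp Require Import all_classical all_reals all_analysis.
From mathcomp Require Import measurable_realfun.
From mathcomp Require Import ring lra zify.
Set Implicit Arguments. Unset Strict Implicit. Unset Printing Implicit Defensive.
Import Order.TTheory GRing.Theory Num.Theory.
Import numFieldNormedType.Exports.
Local Open Scope classical_set_scope.
Local Open Scope ring_scope.

(**
  Best responses in distinct (player, environment) cells are independent and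
  uniform, so until a player meets an environment for the second time the play
  is driven by fresh uniform draws.  From that repetition on the play is
  periodic; if it converges, the profile must have been constant during the
  [n - 1] moves before the repetition, and for fresh draws this has probability
  at most [1/q] at any given time.  On the other hand, the player with the most
  actions has only [q] environments, and in successive rounds of fresh draws
  the environments he meets are independent and uniform, so by the birthday
  paradox a repetition occurs within [2c] rounds except with probability at
  most [(1 - c/q)^c <= 1/(1 + c^2/q)].  The probability of convergence is thus
  at most [(2c+1) n / q + 1/(1 + c^2/q)]; since [n] is at most logarithmic in
  [q], a number of rounds [c] of order [q/(k n)] makes this [O(1/k)].
*)

(** * Exchangeability of independent payoffs *)

Section Exchangeability.
Context (R : realType) (K : finType).

(** A pi-system generating the product sigma-algebra on [K -> R]; independence prescribes the joint
    law of the payoffs exactly on these boxes. *)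
Definition rectangles : set (set (K -> R)) :=
  [set E | exists2 B : K -> set R, (forall k, measurable (B k)) &
           E = [set u | forall k, B k (u k)]].

Lemma rectanglesI : setI_closed rectangles.
Proof.
move=> _ _ [B mB ->] [C mC ->]; exists (fun k => B k `&` C k).
  by move=> k; exact: measurableI.
apply/seteqP; split => u /=; first by case=> H1 H2 k; split.
by move=> H; split => k; case: (H k).
Qed.

Let KR : measurableType _ := g_sigma_algebraType rectangles.

Lemma measurable_eval (k : K) : measurable_fun setT (fun u : KR => u k).
Proof.
move=> _ B mB; rewrite setTI; apply: sub_sigma_algebra.
exists (fun l => if l == k then B else setT) => [l|]; first by case: ifP.
apply/seteqP; split => u /=; first by move=> Bu l; case: eqP => // ->.
by move=> /(_ k); rewrite eqxx.
Qed.

Lemma measurable_family (d : measure_display) (T : measurableType d)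
    (V : K -> T -> R) : (forall k, measurable_fun setT (V k)) ->
  measurable_fun setT (fun w : T => (fun k => V k w) : KR).
Proof.
move=> mV; apply: (@measurability _ _ T KR _ _ rectangles erefl).
move=> _ [_ [B mB ->] <-]; rewrite setTI.
have -> : (fun w => V^~ w) @^-1` [set u | forall k, B k (u k)] =
          \bigcap_(k in [set: K]) (V k @^-1` B k).
  by apply/seteqP; split => w /= H k; [move=> _|]; exact: H.
apply: fin_bigcap_measurable => // k _.
by rewrite -[_ @^-1` _]setTI; exact: mV.
Qed.

Context (d : measure_display) (T : measurableType d) (V : K -> T -> R).
Hypothesis mV : forall k, measurable_fun setT (V k).
Context (P : probability T R) (mu : probability R R) (Z : set T).
Hypothesis mZ : measurable Z.
Hypothesis indepV : forall B : K -> set R, (forall k, measurable (B k)) ->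
  P (Z `&` [set w | forall k, B k (V k w)]) = (P Z * \prod_k mu (B k))%E.

(** All payoffs have the same marginal [mu], so permuting the family only reorders the product of
    marginals. The two image measures thus agree on boxes, hence on every measurable set. *)
Lemma law_perm (s : {perm K}) (E : set (K -> R)) :
  measurable (E : set KR) ->
  P (Z `&` [set w | E (fun k => V k w)]) =
  P (Z `&` [set w | E (fun k => V (s k) w)]).
Proof.
move=> mE.
pose f1 (w : T) : KR := fun k => V k w.
pose f2 (w : T) : KR := fun k => V (s k) w.
have mf1 : measurable_fun setT f1 by exact: measurable_family.
have mf2 : measurable_fun setT f2 by exact: (measurable_family (fun k => mV (s k))).
have pE (f : T -> KR) (A : set KR) :
    pushforward (mrestr P mZ) f A = P (Z `&` f @^-1` A).
  by rewrite /pushforward /mrestr setIC.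
rewrite -(pE f1) -(pE f2).
apply: (@measure_unique _ R KR rectangles (fun _ => setT) erefl rectanglesI
  _ _ (pushforward (mrestr P mZ) f1) (pushforward (mrestr P mZ) f2)) => //.
- by move=> _; exists (fun=> setT) => //; apply/esym/seteqP.
- by rewrite bigcup_const.
- move=> _ [B mB ->]; rewrite /= !pE (indepV mB).
  have -> : (f2 @^-1` [set u : K -> R | forall k, B k (u k)]) =
      [set w | forall k, B (s^-1 k)%g (V k w)].
    apply/seteqP; split => w /= H k; last by have := H (s k); rewrite permK.
    by have := H (s^-1%g k); rewrite /f2 /= permKV.
  rewrite (indepV (B := fun k => B (s^-1%g k))); last by move=> k; exact: mB.
  by rewrite [in RHS](reindex_perm s) /=; under [in RHS]eq_bigr do rewrite permK.
- move=> _; rewrite /= pE (le_lt_trans (probability_le1 P _)) ?ltry//.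
  by apply: measurableI => //; rewrite preimage_setT.
Qed.

Variable cell : K -> {set K}.
Hypothesis cell_refl : forall k, k \in cell k.
Hypothesis cell_eq : forall k l, l \in cell k -> cell l = cell k.

(** Strictness makes the events for two elements of one cell disjoint. *)
Definition strict_best (u : K -> R) (k : K) : Prop :=
  forall l, l \in cell k -> l != k -> u l < u k.

Definition all_best (ks : seq K) : set (K -> R) :=
  [set u | forall k, k \in ks -> strict_best u k].

Lemma measurable_all_best ks : measurable (all_best ks : set KR).
Proof.
have -> : all_best ks = \bigcap_(kl in [set kl : K * K |
    [&& kl.1 \in ks, kl.2 \in cell kl.1 & kl.2 != kl.1]]) [set u | u kl.2 < u kl.1].
  apply/seteqP; split => u /=; first by move=> H [k l] /and3P[? ? ?]; exact: H.
  by move=> H k kks l lk lnk; apply: (H (k, l)); rewrite /= kks lk.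
apply: fin_bigcap_measurable => // -[k l] _ /=.
have := measurable_fun_ltr (measurable_eval l) (measurable_eval k).
by move=> /(_ measurableT [set true] I); rewrite setTI.
Qed.

(** The transposition acts inside a single cell: it carries the maximum there from [l] to [k] and
    fixes the cells of [ks] pointwise. *)
Lemma all_best_tperm ks k l (u : K -> R) : l \in cell k ->
    (forall k', k' \in ks -> cell k' != cell k) ->
  all_best (l :: ks) u -> all_best (k :: ks) (fun x => u (tperm k l x)).
Proof.
move=> lk ncell H k'; rewrite inE => /orP[/eqP -> | k'ks] x xk' xnk'.
  rewrite tpermL; apply: (H l); first by rewrite mem_head.
    rewrite (cell_eq lk); case: tpermP xnk' => [->||_ _ _] //.
  by rewrite -(inj_eq (@perm_inj _ (tperm k l))) tpermL in xnk'.
have neq y : y \in cell k' -> y != k /\ y != l.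
  move=> /cell_eq yk'; have := ncell _ k'ks; rewrite -yk' => ncy.
  split; apply: contra ncy => /eqP ->; first by [].
  by rewrite (cell_eq lk).
have [xk xl] := neq _ xk'; have [k'k k'l] := neq _ (cell_refl k').
by rewrite !tpermD 1?eq_sym //; apply: (H k') => //; rewrite inE k'ks orbT.
Qed.

Lemma measurable_all_bestV ks :
  measurable (Z `&` [set w | all_best ks (fun k => V k w)]).
Proof.
apply: measurableI => //.
have := measurable_family mV measurableT (measurable_all_best ks).
by rewrite setTI.
Qed.

(* Exchanging two payoffs of a cell shows that each of its elements is equally
   likely to be the strict maximum, whatever happens in the other cells. *)
Lemma prob_all_best ks : uniq [seq cell k | k <- ks] ->
  (P (Z `&` [set w | all_best ks (fun k => V k w)]) <=
   P Z * (\prod_(k <- ks) #|cell k|%:R^-1)%:E)%E.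
Proof.
elim: ks => [_|k ks IH /= /andP[kks /IH {}IH]].
  rewrite big_nil mule1 le_measure ?inE//; first exact: measurable_all_bestV.
have ncell k' : k' \in ks -> cell k' != cell k.
  by move=> k'ks; apply: contraNneq kks => <-; exact: map_f.
pose F l := Z `&` [set w | all_best (l :: ks) (fun k => V k w)].
have PF l : l \in cell k -> P (F l) = P (F k).
  move=> lk; rewrite [RHS](law_perm (tperm k l) (measurable_all_best _)).
  congr (P (Z `&` _)); apply/seteqP; split => w /= H.
    exact: (@all_best_tperm ks k l (V^~ w)).
  have lc := cell_eq lk.
  have := @all_best_tperm ks l k (fun x => V (tperm k l x) w); rewrite lc.
  move=> /(_ (cell_refl k) ncell H); rewrite tpermC.
  by under eq_fun do rewrite tpermK.
have card_gt0 : (0 < #|cell k|)%N by apply/card_gt0P; exists k.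
(* The events [F l], for [l] in the cell of [k], are disjoint and all imply the event for [ks]. *)
have sumF : (\sum_(i < #|cell k|) P (F (enum_val i)) <=
    P (Z `&` [set w | all_best ks (fun k => V k w)]))%E.
  rewrite -(@measure_bigsetU_ord _ _ _ P _ xpredT (fun i => F (enum_val i))) //.
  - rewrite le_measure ?inE //; last 1 first.
    + move=> w; rewrite -bigcup_seq => -[i _ [Zw H]]; split => // k' k'ks.
      by apply: H; rewrite inE k'ks orbT.
    + by apply: bigsetU_measurable => i _; exact: measurable_all_bestV.
    + exact: measurable_all_bestV.
  - by move=> i; exact: measurable_all_bestV.
  - move=> i j _ _ [w [[_ Hi] [_ Hj]]]; apply: contrapT => /eqP ij.
    have ci := enum_valP i; have cj := enum_valP j.
    have nij : enum_val i != enum_val j by rewrite (inj_eq enum_val_inj).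
    have := Hi _ (mem_head _ _) (enum_val j); have := Hj _ (mem_head _ _) (enum_val i).
    rewrite (cell_eq ci) (cell_eq cj) => /(_ ci nij) lt1 /(_ cj).
    by rewrite eq_sym => /(_ nij); rewrite ltNge (ltW lt1).
rewrite big_cons mulrC EFinM muleA.
rewrite lee_pdivlMr ?ltr0n //.
apply: le_trans IH; apply: le_trans sumF.
rewrite (eq_bigr (fun=> P (F k))); last by move=> i _; rewrite PF ?enum_valP.
by rewrite sumr_const card_ord mule_natr /enatmul /Algebra.natmul.
Qed.

End Exchangeability.

(** * Ties of atomless variables, and finite unions under outer measure *)

Lemma prob_eq_atomless (R : realType) (mu : probability R R)
    (d : measure_display) (T : measurableType d) (P : probability T R)
    (X Y : T -> R) :
  (forall x : R, mu [set x] = 0%E) ->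
  measurable_fun setT X -> measurable_fun setT Y ->
  (forall A B : set R, measurable A -> measurable B ->
     P (X @^-1` A `&` Y @^-1` B) = (mu A * mu B)%E) ->
  P [set w | X w = Y w] = 0%E.
Proof.
move=> mu0 mX mY XY.
pose h w := (X w, Y w).
have mh : measurable_fun setT h by exact: measurable_fun_pair.
pose D : set (R * R) := [set xy | xy.1 = xy.2].
have mD : measurable D.
  have := measurable_fun_eqr (@measurable_fst _ _ R R) (@measurable_snd _ _ R R).
  move=> /(_ measurableT [set true] I); rewrite setTI => mD.
  rewrite [D](_ : _ = (fun x : R * R => x.1 == x.2) @^-1` [set true])//.
  by apply/seteqP; split => -[x y]; rewrite /D /= => /eqP.
(* The joint law is the product of [mu] with itself, and the sections of the diagonal are
   singletons, hence null. *)
have := @product_measure_unique _ _ _ _ R mu mu (pushforward P h) XY D mD.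
rewrite /= /product_measure1 /= => /(_ mh) E.
transitivity (pushforward P h D); first by [].
rewrite -E integral0_eq // => x _ /=.
rewrite (_ : xsection D x = [set x]) //.
by apply/seteqP; split => y; rewrite /xsection /= inE /D /= => ->.
Qed.

Lemma mu_ext_union_le (R : realType) (d : measure_display) (T : measurableType d)
    (P : {measure set T -> \bar R}) (I : eqType) (r : seq I) (F : I -> set T)
    (A : set T) :
  (forall w, A w -> exists2 i, i \in r & F i w) ->
  (mu_ext P A <= \sum_(i <- r) mu_ext P (F i))%E.
Proof.
elim: r A => [|i r IH] A AF.
  rewrite big_nil [A](_ : _ = set0) ?mu_ext0 //.
  by apply/seteqP; split => // w /AF[].
rewrite big_cons; apply: (@le_trans _ _ (mu_ext P (F i `|` (A `\` F i)))).
  by apply: le_mu_ext => w Aw; have [?|?] := pselect (F i w); [left|right].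
apply: (le_trans (outer_measureU2 _ _ _)); rewrite leeD2l //.
apply: IH => w [/AF[j]]; rewrite inE => /orP[/eqP -> //|jr Fj _]; by exists j.
Qed.

(** * Cells, histories and the deterministic dynamic *)

Local Notation set_act a i x := (@upd _ _ a i x).

Section Cells.
Variables (n : nat) (m : 'I_n -> nat).
Implicit Types (a b : profile m) (i j : 'I_n).

Lemma upd_in a i (x : 'I_(m i)) : set_act a i x i = x.
Proof. by rewrite /upd ffunE dfwithin. Qed.

Lemma upd_out a i (x : 'I_(m i)) j : j != i -> set_act a i x j = a j.
Proof. by move=> ji; rewrite /upd ffunE dfwithout // eq_sym. Qed.

Lemma upd_upd a i (x y : 'I_(m i)) : set_act (set_act a i x) i y = set_act a i y.
Proof.
apply/ffunP => j; have [->|ji] := eqVneq j i; first by rewrite !upd_in.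
by rewrite !upd_out.
Qed.

Lemma upd_id a i : set_act a i (a i) = a.
Proof.
apply/ffunP => j; have [->|ji] := eqVneq j i; first by rewrite !upd_in.
by rewrite !upd_out.
Qed.

(** Encodes the environment of player [k.1]: the pairs whose payoffs one best response compares. *)
Definition cell (k : 'I_n * profile m) : {set 'I_n * profile m} :=
  [set (k.1, set_act k.2 k.1 x) | x : 'I_(m k.1)].

Lemma cell_refl k : k \in cell k.
Proof. by case: k => i a; apply/imsetP; exists (a i); rewrite //= upd_id. Qed.

Lemma cell_eq k l : l \in cell k -> cell l = cell k.
Proof.
case: k => i a /imsetP[x _ -> /=]; apply/setP => k.
by apply/imsetP/imsetP => -[y _ ->]; exists y; rewrite //= upd_upd.
Qed.

Lemma card_cell k : #|cell k| = m k.1.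
Proof.
rewrite card_imset ?card_ord // => x y [] E.
by rewrite -(upd_in k.2 x) E upd_in.
Qed.

Variable R : realType.
Implicit Types u : 'I_n -> profile m -> R.

Definition payoff u (k : 'I_n * profile m) : R := u k.1 k.2.

Lemma br_strict_best u a i : injective (payoff u) ->
  strict_best cell (payoff u) (i, set_act a i (br u i a)).
Proof.
move=> u_inj l; rewrite (_ : cell _ = cell (i, a)); last first.
  by apply: cell_eq; apply/imsetP; exists (br u i a).
case/imsetP => x _ -> nbr.
rewrite lt_neqAle (inj_eq u_inj) nbr /payoff /= /br.
by case: arg_maxP => // y _; exact.
Qed.

Lemma strict_best_unique u k l : cell k = cell l ->
  strict_best cell (payoff u) k -> strict_best cell (payoff u) l -> k = l.
Proof.
move=> E bk bl; apply/eqP; apply: contraT => kl.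
have := bl k; rewrite -E cell_refl => /(_ isT kl) lt1.
have := bk l; rewrite E cell_refl eq_sym => /(_ isT kl).
by rewrite ltNge (ltW lt1).
Qed.

End Cells.

Arguments cell {n m} k.

Section Histories.
Variables (n : nat) (m : 'I_n.+1 -> nat).

Definition player (t : nat) : 'I_n.+1 := Ordinal (ltn_pmod t (ltn0Sn n)).

(* A history is a current profile [a] together with the list [h] of the
   previous profiles, most recent first; [size h] is the current time.
   The pin of move [t] pairs its player with the profile reached, so the cell of
   the pin is the environment that the player responded to. *)
Fixpoint pins (a : profile m) (h : seq (profile m)) : seq ('I_n.+1 * profile m) :=
  if h is b :: h' then (player (size h'), a) :: pins b h' else [::].

Definition fresh (a : profile m) (h : seq (profile m)) : bool :=
  uniq [seq cell k | k <- pins a h].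

(** There are [n.+1] players, so the last [n] moves are those of everyone but the player about to
    move. *)
Definition stalled (a : profile m) (h : seq (profile m)) : bool :=
  all (pred1 a) (take n h).

Variables (R : realType) (u : 'I_n.+1 -> profile m -> R) (a0 : profile m).
Local Notation A := (clockwork u a0).

Fixpoint past (t : nat) : seq (profile m) :=
  if t is t'.+1 then A t' :: past t' else [::].

Lemma size_past t : size (past t) = t.
Proof. by elim: t => //= t ->. Qed.

Lemma nth_past z t j : (j < t)%N -> nth z (past t) j = A (t - j.+1).
Proof.
elim: t j => // t IH [|j] /=; first by rewrite subn1.
by move=> jt; rewrite IH // subSS.
Qed.

Lemma clock_stepE k a :
  clock_step u k a = set_act a (player k) (br u (player k) a).
Proof.
rewrite /clock_step; have -> : (k %% n.+1)%N = val (player k) by [].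
by rewrite valK.
Qed.

Lemma clock_step_mod k l a : k = l %[mod n.+1] -> clock_step u k a = clock_step u l a.
Proof. by rewrite /clock_step => ->. Qed.

Lemma clockworkS t : A t.+1 = clock_step u t (A t).
Proof. by []. Qed.

Lemma mem_pins_past t k : k \in pins (A t) (past t) ->
  exists2 t', (t' < t)%N & k = (player t', A t'.+1).
Proof.
elim: t => //= t IH; rewrite inE size_past => /orP[/eqP ->|/IH[t' t't ->]].
  by exists t.
by exists t' => //; exact: ltnW.
Qed.

Lemma pin_mem_past t t' : (t' < t)%N -> (player t', A t'.+1) \in pins (A t) (past t).
Proof.
elim: t => //= t IH; rewrite ltnS leq_eqVlt inE size_past => /orP[/eqP ->|/IH ->].
  by rewrite eqxx.
by rewrite orbT.
Qed.

Lemma PNE_fixed t s : isPNE u (A t) -> (t <= s)%N -> A s = A t.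
Proof.
move=> pne /subnK <-; elim: (s - t)%N => // k IH.
by rewrite addSn clockworkS IH clock_stepE -pne upd_id.
Qed.

Lemma pin_strict_best t : injective (payoff u) ->
  strict_best cell (payoff u) (player t, A t.+1).
Proof. by move=> u_inj; rewrite clockworkS clock_stepE; exact: br_strict_best. Qed.

(* If a player meets an environment again, the play is periodic from then on, so
   when it converges it is already constant at the first such repetition. *)
Lemma converges_stalled L : injective (payoff u) -> converges u a0 ->
  fresh (A L) (past L) \/
  exists2 t, (n < t < L)%N & fresh (A t) (past t) && stalled (A t) (past t).
Proof.
move=> u_inj [t1 [_ pne]]; have [|notfresh] := boolP (fresh (A L) (past L)).
  by left.
right; have exQ : exists l, ~~ fresh (A l) (past l) by exists L.
(* The empty history is fresh, so the first failure has the form [t.+1]: it is move [t] that repeats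
   an environment. *)
case: (ex_minnP exQ) => -[|t] // Qt tmin.
have tL : (t < L)%N by exact: tmin.
have fresh_t : fresh (A t) (past t).
  by apply: contraT => /tmin; rewrite ltnn.
have [t' t't /esym Et] : exists2 t', (t' < t)%N &
    (player t, A t.+1) = (player t', A t'.+1).
  move: Qt; rewrite /fresh [pins _ _]/= [map _ _]/= cons_uniq.
  rewrite [uniq _]fresh_t andbT negbK size_past.
  case/mapP => k /mem_pins_past[t' t't ->] Ec; exists t' => //.
  by apply: (strict_best_unique Ec); exact: pin_strict_best.
have Ep : t' = t %[mod n.+1] by case: Et.
have EA : A t'.+1 = A t.+1 by case: Et.
(* Moves [t'] and [t] have the same player and outcome, and the dynamic depends only on the profile
   and on the time modulo [n.+1]. *)
have period k : A (t'.+1 + k)%N = A (t.+1 + k)%N.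
  elim: k => [|k IH]; first by rewrite !addn0.
  rewrite !addnS [LHS]clockworkS [RHS]clockworkS IH; apply: clock_step_mod.
  by rewrite !addSn -!addnS -modnDml Ep modnDml.
have periods j k : A (t'.+1 + k)%N = A (t'.+1 + k + j * (t - t'))%N.
  elim: j k => [|j IH] k; first by rewrite addn0.
  rewrite period mulSn addnA (_ : (t'.+1 + k + (t - t') = t'.+1 + (k + (t - t')))%N).
    by rewrite -IH; congr (A _); lia.
  by lia.
(* Shifting by [t1] periods leads beyond time [t1], where the play rests at the equilibrium. *)
have const k : A (t'.+1 + k)%N = A t1.
  rewrite (periods t1); apply: (PNE_fixed pne).
  by rewrite (leq_trans (leq_pmulr t1 (_ : 0 < t - t')%N)) ?subn_gt0 ?leq_addl.
(* A constant play repeats the pin of move [t'] one full round later, so minimality bounds [t]. *)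
have t_le : (t <= t' + n.+1)%N.
  apply: (tmin (t' + n.+1).+1); rewrite /fresh [pins _ _]/= [map _ _]/= cons_uniq.
  rewrite negb_and negbK size_past.
  have -> : (player (t' + n.+1), A (t' + n.+1).+1) = (player t', A t'.+1).
    by congr (_, _); [apply/val_inj; rewrite /= modnDr|
       rewrite -addSn const -[t'.+1]addn0 const].
  by apply/orP; left; apply: map_f; apply: pin_mem_past; lia.
have t_ge : (t' + n.+1 <= t)%N.
  have : (n.+1 %| t - t')%N by rewrite -eqn_mod_dvd ?(ltnW t't) // eq_sym; apply/eqP.
  by move/dvdn_leq; rewrite subn_gt0 => /(_ t't); lia.
(* Now [t = t' + n.+1], so the profile at [t] and its [n] predecessors all lie in the constant
   phase. *)
exists t; first by lia.
rewrite fresh_t /=; apply/(all_nthP a0) => j.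
rewrite size_takel ?size_past; last by lia.
move=> jn; rewrite nth_take // nth_past; last by lia.
have after s : (t' < s)%N -> A s = A t1 by move/subnKC => <-; exact: const.
by rewrite !after //=; lia.
Qed.

End Histories.

(** * Fresh uniform draws *)

Section FreshDraws.
Variables (R : realType) (n : nat) (m : 'I_n.+1 -> nat).
Hypothesis m_gt0 : forall i, (0 < m i)%N.
Implicit Types (a b : profile m) (h : seq (profile m)).
Implicit Types (f g : profile m -> seq (profile m) -> R).

(* Mean of [f] over the histories reached from [(a, h)] after [k] moves, each
   mover drawing a uniform action instead of best-responding. *)
Fixpoint draws k a h f : R :=
  if k is k'.+1 then
    (m (player n (size h)))%:R^-1 *
    \sum_(x : 'I_(m (player n (size h)))) draws k' (set_act a _ x) (a :: h) f
  else f a h.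

Lemma draws_add j k a h f :
  draws (j + k) a h f = draws j a h (fun a' h' => draws k a' h' f).
Proof. by elim: j a h => //= j IH a h; congr (_ * _); apply: eq_bigr. Qed.

Lemma draws_scale k a h f (c : R) :
  draws k a h (fun a' h' => c * f a' h') = c * draws k a h f.
Proof.
elim: k a h => //= k IH a h; rewrite mulrCA; congr (_ * _).
by rewrite mulr_sumr; apply: eq_bigr => x _.
Qed.

Lemma draws_cst k a h (c : R) : draws k a h (fun _ _ => c) = c.
Proof.
elim: k a h => //= k IH a h; rewrite (eq_bigr (fun=> c)) //.
by rewrite sumr_const card_ord -[c *+ _]mulr_natl mulKf // pnatr_eq0 -lt0n.
Qed.

(** The comparison is required only on histories extending [a :: h] by [k] profiles, so that facts
    about earlier moves remain available. *)
Lemma draws_le k a h f g :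
  (forall a' h', (exists2 r, a' :: h' = r ++ a :: h & size r = k) ->
     f a' h' <= g a' h') ->
  draws k a h f <= draws k a h g.
Proof.
elim: k a h => [|k IH] a h fg /=; first by apply: fg; exists [::].
rewrite ler_wpM2l ?invr_ge0 ?ler0n // ler_sum // => x _.
apply: IH => a' h' [r E sr]; apply: fg.
exists (rcons r (set_act a _ x)); last by rewrite size_rcons sr.
by rewrite cat_rcons.
Qed.

(** * Order of the movers, and the law of the drawn profiles *)

Definition movers t k : seq 'I_n.+1 := [seq player n x | x <- iota t k].

Lemma movers_add t j k : movers t (j + k) = movers t j ++ movers (t + j) k.
Proof. by rewrite /movers iotaD map_cat. Qed.

Lemma moversS t k : movers t k.+1 = rcons (movers t k) (player n (t + k)).
Proof. by rewrite -[k.+1]addn1 movers_add cats1. Qed.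

Lemma uniq_movers t k : (k <= n.+1)%N -> uniq (movers t k).
Proof.
move=> kn; rewrite map_inj_in_uniq ?iota_uniq // => x y.
rewrite !mem_iota => /andP[tx xk] /andP[ty yk] [].
have -> : x = (t + (x - t))%N by lia.
have -> : y = (t + (y - t))%N by lia.
move/eqP; rewrite eqn_modDl !modn_small; [move/eqP; lia | lia | lia].
Qed.

Lemma mem_movers t j : j \in movers t n.+1.
Proof.
have sub : {subset movers t n.+1 <= enum 'I_n.+1} by move=> x _; rewrite mem_enum.
have [|_ ->] := uniq_min_size (uniq_movers t (leqnn _)) sub; last by rewrite mem_enum.
by rewrite size_enum_ord size_map size_iota.
Qed.

Lemma prod_movers t (F : 'I_n.+1 -> R) : \prod_(j <- movers t n.+1) F j = \prod_j F j.
Proof.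
rewrite -[RHS]big_enum /=; apply: perm_big; apply: uniq_perm.
- exact: uniq_movers.
- exact: enum_uniq.
- by move=> j; rewrite mem_movers mem_enum.
Qed.

(** Within one round nobody moves twice, so the profile is uniform among those that agree with [a]
    off the movers. *)
Lemma draws_last k a h (g : profile m -> R) : (k <= n.+1)%N ->
  draws k a h (fun a' _ => g a') =
  (\prod_(j <- movers (size h) k) (m j)%:R^-1) *
  \sum_(b : profile m | [forall j, (j \notin movers (size h) k) ==> (b j == a j)]) g b.
Proof.
elim: k a h => [|k IH] a h kn /=.
  rewrite big_nil mul1r (big_pred1 a) // => b /=.
  apply/forallP/eqP => [H|-> j]; last exact: eqxx.
  by apply/ffunP => j; apply/eqP; exact: H.
have /= /andP[p_movers _] := uniq_movers (size h) kn.
rewrite big_cons -mulrA; congr (_ * _).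
under eq_bigr do rewrite (IH _ _ (ltnW kn)) /=.
rewrite -mulr_sumr; congr (_ * _).
rewrite [RHS](partition_big (fun b : profile m => b (player n (size h))) xpredT) //=.
apply: eq_bigr => x _; apply: eq_bigl => b.
apply/forallP/andP => [H|[/forallP H /eqP bx] j].
  split; last by have := H (player n (size h)); rewrite p_movers /= upd_in.
  apply/forallP => j; apply/implyP; rewrite inE negb_or => /andP[jp jr].
  by have := H j; rewrite jr upd_out.
apply/implyP => jr; have [->|jp] := eqVneq j (player n (size h)).
  by rewrite bx upd_in.
by have := H j; rewrite inE (negPf jp) jr upd_out.
Qed.

Lemma draws_round a h (g : profile m -> R) :
  draws n.+1 a h (fun a' _ => g a') =
  (\prod_j (m j)%:R^-1) * \sum_(b : profile m) g b.
Proof.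
rewrite draws_last // prod_movers; congr (_ * _); apply: eq_bigl => b.
by apply/forallP => j; rewrite mem_movers.
Qed.

(** Each draw must hit the mover's action in the fixed profile [b]. *)
Lemma draws_run k a h b :
  draws k a h (fun a' h' => (all (pred1 b) (take k (a' :: h')))%:R) <=
  \prod_(j <- movers (size h) k) (m j)%:R^-1.
Proof.
elim: k a h => [|k IH] a h; first by rewrite /= big_nil.
rewrite [movers _ _]/= big_cons [leLHS]/=.
rewrite ler_wpM2l ?invr_ge0 ?ler0n //.
have step (x : 'I_(m (player n (size h)))) :
    draws k (set_act a _ x) (a :: h)
      (fun a' h' => ((a' == b) && all (pred1 b) (take k h'))%:R) <=
    (x == b (player n (size h)))%:R * \prod_(j <- movers (size h).+1 k) (m j)%:R^-1.
  apply: (@le_trans _ _ ((x == b (player n (size h)))%:R *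
      draws k (set_act a _ x) (a :: h)
        (fun a' h' => (all (pred1 b) (take k (a' :: h')))%:R))); last first.
    by rewrite ler_wpM2l ?ler0n // IH.
  rewrite -draws_scale; apply: draws_le => a' h' [r E sr].
  rewrite -natrM mulnb ler_nat.
  have -> : (a' == b) && all (pred1 b) (take k h') =
      all (pred1 b) (take k.+1 (a' :: h')) by [].
  have -> : take k.+1 (a' :: h') = rcons r (set_act a _ x).
    by rewrite E -cat_rcons take_size_cat // size_rcons sr.
  have -> : take k (a' :: h') = r by rewrite E take_size_cat.
  rewrite all_rcons /=; have [<-|//] := eqVneq (set_act a _ x) b.
  by rewrite upd_in eqxx leqnn.
apply: le_trans (ler_sum _ (fun x _ => step x)) _.
by rewrite -mulr_suml (bigD1 (b _)) //= big1 ?addr0 ?eqxx ?mul1r // => x /negPf ->.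
Qed.

(** Replaces the random final profile of a run by the known starting one, so that [draws_run]
    applies. *)
Lemma run_eq_start r a h a' h' : a' :: h' = r ++ a :: h ->
  all (pred1 a') (take (size r) h') -> all (pred1 a) (take (size r) (a' :: h')).
Proof.
move=> E; rewrite E take_size_cat //; case: r E => [|b r] //= [-> ->].
rewrite -cat_rcons take_size_cat ?size_rcons // all_rcons /=.
by case/andP => /eqP ->; rewrite eqxx.
Qed.

Lemma draws_stalled k (mx : nat) a h : (forall j, (m j <= mx)%N) -> (n <= k)%N ->
  draws k a h (fun a' h' => (stalled a' h')%:R) <= mx%:R / \prod_j (m j)%:R.
Proof.
move=> m_le nk; rewrite -(subnK nk) draws_add.
rewrite -[leRHS](draws_cst (k - n) a h); apply: draws_le => {}a {}h _.
have run : draws n a h (fun a' h' => (stalled a' h')%:R) <=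
    \prod_(j <- movers (size h) n) (m j)%:R^-1.
  apply: le_trans (draws_run n a h a); apply: draws_le => a' h' [r E sr].
  rewrite ler_nat; case st: (stalled a' h') => //; rewrite lt0b.
  by have := run_eq_start E; rewrite sr => ->.
apply: le_trans run _.
have prod_gt0 : 0 < \prod_j (m j)%:R :> R by rewrite prodr_gt0 // => j _; rewrite ltr0n.
rewrite ler_pdivlMr // -(prod_movers (size h) (fun j => (m j)%:R)).
(* The [n] movers of the run are all players but one, whose missing factor is at most [mx]. *)
rewrite moversS -cats1 big_cat /= big_seq1 mulrA -big_split /=.
rewrite big1 ?mul1r ?ler_nat // => j _.
by rewrite mulVf // pnatr_eq0 -lt0n.
Qed.

(** * The birthday bound on staying fresh *)

Lemma pins_cat r a h a' h' : a' :: h' = r ++ a :: h ->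
  exists ks, pins a' h' = ks ++ pins a h.
Proof.
elim: r a' h' => [|b r IH] a' h' /=; first by move=> [-> ->]; exists [::].
case: h' => [|c h'] [-> E]; first by case: r E {IH}.
by have [ks Eks] := IH _ _ E; exists ((player n (size h'), b) :: ks); rewrite /= Eks.
Qed.

Lemma fresh_suffix r a h a' h' : a' :: h' = r ++ a :: h -> fresh a' h' -> fresh a h.
Proof.
by move=> /pins_cat[ks E]; rewrite /fresh E map_cat cat_uniq => /and3P[].
Qed.

Lemma count_pins (i : 'I_n.+1) a h :
  count (fun k => k.1 == i) (pins a h) = count_mem i (movers 0 (size h)).
Proof.
elim: h a => [|b h IH] a //.
by rewrite [size _]/= moversS -cats1 count_cat -(IH b) /= addn0 addnC.
Qed.

Lemma count_movers (i : 'I_n.+1) c : count_mem i (movers 0 (c * n.+1)) = c.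
Proof.
elim: c => // c IH; rewrite mulSnr movers_add count_cat IH.
by rewrite count_uniq_mem ?uniq_movers // mem_movers addn1.
Qed.

Lemma card_cell_fiber (i : 'I_n.+1) (d : profile m) :
  (m i <= #|[pred b : profile m | cell (i, b) == cell (i, d)]|)%N.
Proof.
rewrite -[leqLHS]card_ord -(@card_imset _ _ (fun x : 'I_(m i) => set_act d i x)).
  apply/subset_leq_card/fintype.subsetP => b /imsetP[x _ ->]; rewrite inE; apply/eqP.
  by apply: cell_eq; apply/imsetP; exists x.
by move=> x y E; rewrite -(upd_in d x) E upd_in.
Qed.

(** Each cell of [s] excludes at least [m i] profiles, and distinct cells exclude different ones. *)
Lemma sum_avoid (i : 'I_n.+1) (s : seq {set 'I_n.+1 * profile m}) :
  uniq s -> (forall C, C \in s -> exists d, C = cell (i, d)) ->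
  \sum_(b : profile m) (cell (i, b) \notin s)%:R <=
  \prod_l (m l)%:R - (size s)%:R * (m i)%:R :> R.
Proof.
move=> us sP; rewrite lerBrDr.
have -> : \prod_l (m l)%:R = \sum_(b : profile m) 1 :> R.
  rewrite sumr_const card_dep_ffun foldrE big_map big_enum /= natr_prod.
  by apply: eq_bigr => l _; rewrite card_ord.
have le_s : (size s)%:R * (m i)%:R <= \sum_(b : profile m) (cell (i, b) \in s)%:R :> R.
  rewrite (eq_bigr (fun b => \sum_(C <- s) (cell (i, b) == C)%:R)); last first.
    move=> b _; rewrite -natr_sum; congr _%:R.
    rewrite -count_uniq_mem // -sum1_count big_mkcond /=.
    by apply: eq_bigr => C _; rewrite eq_sym; case: ifP.
  rewrite exchange_big /= mulr_natl.
  have -> : (m i)%:R *+ size s = \sum_(C <- s) (m i)%:R :> R.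
    by rewrite big_const_seq count_predT iter_addr_0.
  rewrite big_seq [leRHS]big_seq ler_sum // => C /sP[d ->].
  rewrite -natr_sum ler_nat (leq_trans (card_cell_fiber i d)) //.
  by rewrite -sum1_card big_mkcond /= leq_sum // => b _; rewrite inE; case: ifP.
rewrite (le_trans (lerD (lexx _) le_s)) // -big_split /= ler_sum // => b _.
by case: (_ \in s); rewrite ?add0r ?addr0.
Qed.

(** The first hypothesis makes [i] the last mover of each round. A round ends in a uniform profile,
    so the environment [i] has just met is uniform and must avoid at least [c] earlier ones. *)
Lemma draws_fresh (i : 'I_n.+1) c j a h :
  player n (size h + n) = i ->
  c%:R * (m i)%:R <= \prod_l (m l)%:R :> R ->
  (c <= count (fun k => k.1 == i) (pins a h))%N ->
  draws (j * n.+1) a h (fun a' h' => (fresh a' h')%:R) <=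
  (1 - c%:R * (m i)%:R / \prod_l (m l)%:R) ^+ j.
Proof.
move=> + c_le; set x := 1 - _.
have prod_gt0 : 0 < \prod_j (m j)%:R :> R by rewrite prodr_gt0 // => l _; rewrite ltr0n.
have x_ge0 : 0 <= x by rewrite subr_ge0 ler_pdivrMr // mul1r.
elim: j a h => [|j IH] a h hi cnt; first by rewrite expr0 /=; case: fresh.
have [fr|nfr] := boolP (fresh a h); last first.
  rewrite (le_trans _ (exprn_ge0 _ x_ge0)) // -[leRHS](draws_cst (j.+1 * n.+1) a h).
  apply: draws_le => a' h' [r /fresh_suffix E _].
  by case f: fresh => //; rewrite E in nfr.
pose s := [seq cell k | k <- pins a h & k.1 == i].
have us : uniq s by rewrite (subseq_uniq _ fr) // map_subseq ?filter_subseq.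
have size_s : (c <= size s)%N by rewrite size_map size_filter.
rewrite mulSn draws_add exprS mulrC.
(* If the first round ends in a known cell, freshness is lost for good; otherwise induction handles
   the other rounds. *)
apply: (@le_trans _ _ (draws n.+1 a h (fun a' _ => x ^+ j * (cell (i, a') \notin s)%:R))).
  apply: draws_le => a' h' [r E sr].
  have [ks Ek] := pins_cat E.
  have size_h' : size h' = (size h + n).+1.
    by have /= := congr1 size E; rewrite size_cat /= sr; lia.
  have [Cs|] := boolP (cell (i, a') \in s); last first.
    move=> _; rewrite mulr1; apply: IH.
      by rewrite size_h' -hi; apply/val_inj; rewrite /= addSnnS modnDr.
    by rewrite Ek count_cat (leq_trans cnt) ?leq_addl.
  rewrite mulr0 -[leRHS](draws_cst (j * n.+1) a' h').
  apply: draws_le => a2 h2 [r2 /fresh_suffix E2 _]; case f: fresh => //.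
  have := E2 f; move: Ek size_h'; rewrite /fresh.
  case: h' E {E2} => // b h' E /= Ek [sh]; rewrite sh hi => /andP[+ _].
  suff -> : cell (i, a') \in [seq cell k | k <- pins b h'] by [].
  case: r E sr => // b' r [_ /pins_cat[ks' ->]] _.
  rewrite map_cat mem_cat; apply/orP; right.
  by move/mapP: Cs => [k]; rewrite mem_filter => /andP[_ kp] ->; exact: map_f.
rewrite draws_scale ler_wpM2l ?exprn_ge0 // draws_round.
apply: (@le_trans _ _ ((\prod_l (m l)%:R^-1) *
    (\prod_l (m l)%:R - (size s)%:R * (m i)%:R))).
  rewrite ler_wpM2l //; last first.
    apply: sum_avoid => // C /mapP[[i' d]]; rewrite mem_filter => /andP[/eqP /= -> _] ->.
    by exists d.
  by rewrite prodr_ge0 // => l _; rewrite invr_ge0 ler0n.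
rewrite prodfV mulrBr mulVf ?gt_eqF // /x lerD2l lerN2 [_^-1 * _]mulrC.
by rewrite ler_pM2r ?invr_gt0 // ler_wpM2r ?ler0n ?ler_nat.
Qed.

(** The first [c] rounds give [i] a stock of [c] environments, the [i.+1] extra moves align the
    rounds to end with [i], and each of the last [c] rounds contributes a factor. *)
Lemma draws_fresh_rounds (i : 'I_n.+1) c a :
  c%:R * (m i)%:R <= \prod_l (m l)%:R :> R ->
  draws (c * n.+1 + i.+1 + c * n.+1) a [::] (fun a' h' => (fresh a' h')%:R) <=
  (1 - c%:R * (m i)%:R / \prod_l (m l)%:R) ^+ c.
Proof.
move=> c_le; rewrite draws_add -[leRHS](draws_cst (c * n.+1 + i.+1) a [::]).
apply: draws_le => a' h' [r E sr].
have size_h' : size h' = (c * n.+1 + i.+1)%N.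
  by have /= := congr1 size E; rewrite size_cat /= sr; lia.
apply: draws_fresh => //.
  apply/val_inj; rewrite /= size_h' -addnA modnMDl addSnnS modnDr modn_small //.
by rewrite count_pins size_h' movers_add count_cat count_movers leq_addr.
Qed.

End FreshDraws.

(** * From payoffs to fresh draws *)

Section Transfer.
Context (R : realType) (mu : probability R R).
Hypothesis mu_atomless : forall x : R, mu [set x] = 0%E.
Context (n : nat) (m : 'I_n.+1 -> nat).
Hypothesis m_gt0 : forall i, (0 < m i)%N.
Context (d : measure_display) (T : measurableType d) (P : probability T R).
Context (U : 'I_n.+1 -> profile m -> T -> R) (A0 : T -> profile m).
Hypothesis mU : forall i a, measurable_fun setT (U i a).
Hypothesis lawU : forall i a (B : set R), measurable B -> P (U i a @^-1` B) = mu B.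
Hypothesis mA0 : forall a, measurable (A0 @^-1` [set a]).
Hypothesis lawA0 : forall a, P (A0 @^-1` [set a]) = (#|profile m|%:R^-1)%:E.
Hypothesis indep : forall (S : set (profile m)) (B : 'I_n.+1 -> profile m -> set R),
  (forall i a, measurable (B i a)) ->
  P (A0 @^-1` S `&` [set w | forall i a, B i a (U i a w)]) =
  (P (A0 @^-1` S) * \prod_(i < n.+1) \prod_(a : profile m) P (U i a @^-1` B i a))%E.

Let K : finType := ('I_n.+1 * profile m)%type.
Let V (k : K) (w : T) : R := U k.1 k.2 w.
Let u (w : T) : 'I_n.+1 -> profile m -> R := fun i a => U i a w.

Let mV k : measurable_fun setT (V k). Proof. exact: mU. Qed.

Lemma indep_cells (S : set (profile m)) (B : K -> set R) :
  (forall k, measurable (B k)) ->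
  P (A0 @^-1` S `&` [set w | forall k, B k (V k w)]) =
  (P (A0 @^-1` S) * \prod_k mu (B k))%E.
Proof.
move=> mB; have := @indep S (fun i a => B (i, a)) (fun i a => mB (i, a)).
rewrite pair_bigA /= => E; transitivity (P (A0 @^-1` S `&`
    [set w | forall i a, B (i, a) (U i a w)])).
  congr (P (_ `&` _)); apply/seteqP; split => w /= H; last by case=> i a; exact: H.
  by move=> i a; exact: (H (i, a)).
by rewrite E; congr (_ * _)%E; apply: eq_bigr => -[i a] _; rewrite /= lawU.
Qed.

Lemma prob_tie k l : k != l -> P [set w | V k w = V l w] = 0%E.
Proof.
move=> kl; apply: (prob_eq_atomless mu_atomless) => // A B mA mB.
pose C x := if x == k then A else if x == l then B else setT.
have mC x : measurable (C x) by rewrite /C; case: ifP => // _; case: ifP.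
have := indep_cells setT mC; rewrite preimage_setT setTI probability_setT mul1e.
rewrite (bigD1 k) //= (bigD1 l) //=; last by rewrite eq_sym.
rewrite big1 ?mule1; last first.
  by move=> x /andP[xk xl]; rewrite /C (negPf xk) (negPf xl) probability_setT.
rewrite /C eqxx (eq_sym l) (negPf kl) eqxx => <-; congr (P _).
apply/seteqP; split => w /=; last first.
  by move=> H; split; [have := H k|have := H l]; rewrite /C eqxx // eq_sym (negPf kl).
by move=> [Aw Bw] x; case: eqP => [->//|_]; case: eqP => [->//|].
Qed.

Lemma mu_ext_ties : mu_ext P [set w | ~ injective (payoff (u w))] = 0%E.
Proof.
apply/eqP; rewrite eq_le mu_ext_ge0 // andbT.
pose F (kl : K * K) := if kl.1 == kl.2 then set0 else [set w | V kl.1 w = V kl.2 w].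
apply: (@le_trans _ _ (\sum_(kl <- enum {: K * K}) mu_ext P (F kl))%E).
  apply: mu_ext_union_le => w ninj.
  have [[k l] /= klP] : exists kl : K * K, kl.1 <> kl.2 /\ V kl.1 w = V kl.2 w.
    apply: contrapT => H; apply: ninj => k l kl; apply: contrapT => nkl.
    by apply: H; exists (k, l).
  exists (k, l); first by rewrite mem_enum.
  by rewrite /F /=; case: klP => /eqP /negPf ->.
rewrite big1 // => -[k l] _; rewrite /F /=; case: ifPn => [_|kl]; first exact: mu_ext0.
rewrite measurable_mu_extE; first exact: prob_tie.
have := measurable_fun_eqr (mV k) (mV l) measurableT (Y := [set true]) I.
rewrite setTI => mE.
have -> : [set w | V k w = V l w] = (fun x => V k x == V l x) @^-1` [set true].
  by apply/seteqP; split => w /= /eqP.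
by [].
Qed.

(** * Outer measure of the plays that follow a given history *)

Definition weight (a : profile m) (h : seq (profile m)) : R :=
  #|profile m|%:R^-1 * \prod_(k <- pins a h) (m k.1)%:R^-1.

Lemma weight_ge0 a h : 0 <= weight a h.
Proof.
by rewrite mulr_ge0 ?invr_ge0 ?ler0n // prodr_ge0 // => k _; rewrite invr_ge0 ler0n.
Qed.

(* The plays without ties that have history [(a, h)] at time [size h], and whose
   history [k] moves later is fresh and satisfies [Phi]. Bounding their outer
   measure spares us their measurability. *)
Definition extend k a h (Phi : profile m -> seq (profile m) -> bool) : set T :=
  [set w | let A := clockwork (u w) (A0 w) in
           let H := past (u w) (A0 w) in
    [/\ injective (payoff (u w)), A (size h) = a /\ H (size h) = h,
        fresh (A (size h + k)%N) (H (size h + k)%N) &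
        Phi (A (size h + k)%N) (H (size h + k)%N)]].

Lemma last_past (v : 'I_n.+1 -> profile m -> R) a0 t :
  last (clockwork v a0 t) (past v a0 t) = a0.
Proof. by elim: t. Qed.

(** For [k = 0], the pins of a fresh history are strict maxima of distinct cells, so [prob_all_best]
    gives the weight. A further move is split according to the action played. *)
Lemma prob_extend k a h Phi :
  (mu_ext P (extend k a h Phi) <=
   (weight a h * draws k a h (fun a' h' => (Phi a' h')%:R))%:E)%E.
Proof.
elim: k a h => [|k IH] a h.
  have [/andP[fr Ph]|nfP] := boolP (fresh a h && Phi a h); last first.
    rewrite (_ : extend _ _ _ _ = set0) ?mu_ext0 // ?lee_fin /=.
      by apply: mulr_ge0; [exact: weight_ge0|exact: ler0n].
    apply/seteqP; split => // w /=; rewrite /extend /= addn0 => -[_ [-> ->] fr Ph].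
    by rewrite fr Ph in nfP.
  pose Z := A0 @^-1` [set last a h].
  pose E := Z `&` [set w | all_best cell (pins a h) (fun k => V k w)].
  apply: (@le_trans _ _ (mu_ext P E)).
    apply: le_mu_ext => w [inj [Ea Eh] _ _]; split.
      by have := last_past (u w) (A0 w) (size h); rewrite Ea Eh.
    move=> l lah; have := @mem_pins_past _ _ _ (u w) (A0 w) (size h) l.
    rewrite Ea Eh => /(_ lah)[t' _ ->].
    exact: (@pin_strict_best _ _ _ (u w) (A0 w) t' inj).
  have mZ : measurable Z by exact: mA0.
  rewrite measurable_mu_extE; last exact: measurable_all_bestV.
  have := prob_all_best mV mZ (@indep_cells [set last a h])
    (@cell_refl _ m) (@cell_eq _ m) fr.
  rewrite /E lawA0 -EFinM /= Ph mulr1 /weight => /le_trans; apply.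
  by rewrite lee_fin; under eq_bigr do rewrite card_cell.
apply: (@le_trans _ _ (\sum_(x <- enum 'I_(m (player n (size h))))
    mu_ext P (extend k (set_act a _ x) (a :: h) Phi))%E).
  apply: mu_ext_union_le => w [inj [Ea Eh] fr Ph].
  exists (br (u w) (player n (size h)) a); first by rewrite mem_enum.
  rewrite /extend /= -addSnnS in fr Ph *; split => //; split.
    by rewrite Ea [LHS](clock_stepE _ (size h)).
  by rewrite Ea Eh.
apply: (@le_trans _ _ (\sum_(x <- enum 'I_(m (player n (size h))))
    (weight a h * (m (player n (size h)))%:R^-1 *
     draws k (set_act a _ x) (a :: h) (fun a' h' => (Phi a' h')%:R))%:E)%E).
  apply: lee_sum => x _; apply: (le_trans (IH _ _)).
  by rewrite lee_fin /weight /= big_cons -!mulrA [X in _ * X]mulrCA.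
by rewrite sumEFin big_enum /= -mulr_sumr mulrA.
Qed.

Lemma mu_ext_converges (i : 'I_n.+1) c : (forall j, (m j <= m i)%N) ->
  c%:R * (m i)%:R <= \prod_l (m l)%:R :> R ->
  (mu_ext P [set w | converges (u w) (A0 w)] <=
   ((c.*2.+1 * n.+1)%:R * ((m i)%:R / \prod_l (m l)%:R) +
    (1 - c%:R * (m i)%:R / \prod_l (m l)%:R) ^+ c)%:E)%E.
Proof.
move=> m_le c_le; pose L := (c * n.+1 + i.+1 + c * n.+1)%N.
pose F t a := extend t a [::] (@stalled n m).
pose G a := extend L a [::] (@fresh n m).
set q := (m i)%:R / _; set e := (1 - _) ^+ c.
pose E := [set w | exists2 a, a \in enum (profile m) &
                 G a w \/ exists2 t, t \in iota n.+1 (L - n.+1) & F t a w].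
have conv_sub : [set w | converges (u w) (A0 w)] `<=`
    [set w | ~ injective (payoff (u w))] `|` E.
  move=> w cw; have [inj|] := pselect (injective (payoff (u w))); last by left.
  right; exists (A0 w); first by rewrite mem_enum.
  have [fr|[t /andP[nt tL] /andP[fr st]]] := converges_stalled L inj cw.
    by left; split.
  by right; exists t; [rewrite mem_iota; lia|split].
have q_ge0 : 0 <= q by rewrite mulr_ge0 ?ler0n // invr_ge0 prodr_ge0.
have leF t a : (n < t)%N -> (mu_ext P (F t a) <= (#|profile m|%:R^-1 * q)%:E)%E.
  move=> nt; apply: (le_trans (prob_extend _ _ _ _)); rewrite lee_fin.
  rewrite /weight /= big_nil mulr1 ler_wpM2l ?invr_ge0 ?ler0n //.
  by apply: draws_stalled => //; exact: ltnW.
have leG a : (mu_ext P (G a) <= (#|profile m|%:R^-1 * e)%:E)%E.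
  apply: (le_trans (prob_extend _ _ _ _)); rewrite lee_fin.
  rewrite /weight /= big_nil mulr1 ler_wpM2l ?invr_ge0 ?ler0n //.
  exact: draws_fresh_rounds.
have leGF a : (mu_ext P [set w | G a w \/
      exists2 t, t \in iota n.+1 (L - n.+1) & F t a w] <=
    (#|profile m|%:R^-1 * ((c.*2.+1 * n.+1)%:R * q + e))%:E)%E.
  rewrite mulrDr addrC EFinD.
  apply: (le_trans (outer_measureU2 _ (G a) [set w |
      exists2 t, t \in iota n.+1 (L - n.+1) & F t a w])).
  apply: leeD; first exact: leG.
  apply: (@le_trans _ _ (\sum_(t <- iota n.+1 (L - n.+1)) mu_ext P (F t a))%E).
    exact: mu_ext_union_le.
  apply: (@le_trans _ _ (\sum_(t <- iota n.+1 (L - n.+1)) (#|profile m|%:R^-1 * q)%:E)%E).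
    rewrite big_seq [leRHS]big_seq lee_sum // => t; rewrite mem_iota => /andP[nt _].
    exact: leF.
  rewrite sumEFin lee_fin big_const_seq count_predT size_iota iter_addr_0.
  rewrite -[_ *+ (L - _)]mulr_natl mulrCA ler_wpM2l ?invr_ge0 ?ler0n //.
  rewrite ler_wpM2r // ler_nat.
  (* Since [i.+1 <= n.+1], the horizon [L] is at most [2c+1] rounds. *)
  by rewrite /L; have := ltn_ord i; nia.
apply: (le_trans (le_mu_ext _ conv_sub)).
apply: (le_trans (outer_measureU2 _ _ _)).
rewrite [X in (X + _ <= _)%E]mu_ext_ties add0e.
apply: (le_trans (mu_ext_union_le (F := fun a => [set w | G a w \/
      exists2 t, t \in iota n.+1 (L - n.+1) & F t a w]) (r := enum (profile m)) _ _)).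
  by [].
apply: (le_trans (lee_sum _ (fun a _ => leGF a))).
rewrite sumEFin lee_fin big_enum /= sumr_const -[leLHS]mulr_natl mulrA divff ?mul1r //.
by rewrite pnatr_eq0 -lt0n; apply/card_gt0P; exists [ffun j => Ordinal (m_gt0 j)].
Qed.

(** * Measurability of the event of convergence *)

Lemma br_ext (v v' : 'I_n.+1 -> profile m -> R) :
  (forall k l, (payoff v k <= payoff v l) = (payoff v' k <= payoff v' l)) ->
  forall i a, br v i a = br v' i a.
Proof.
move=> vv' i a; rewrite /br /Order.arg_max /extremum; congr odflt.
apply: eq_pick => x /=.
by apply: eq_forallb => y /=; exact: (vv' (i, _) (i, _)).
Qed.

(** Convergence depends only on the initial profile and the finite table of payoff comparisons, so
    the event is a finite union of fibres of [code]. *)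
Lemma measurable_converges : measurable [set w | converges (u w) (A0 w)].
Proof.
pose code w : profile m * {ffun K * K -> bool} :=
  (A0 w, [ffun kl => V kl.1 w <= V kl.2 w]).
have code_conv w w' : code w = code w' ->
    converges (u w) (A0 w) -> converges (u w') (A0 w').
  move=> [<- /ffunP E].
  have brE j a : br (u w) j a = br (u w') j a.
    by apply: br_ext => k l; have := E (k, l); rewrite !ffunE.
  have cE t : clockwork (u w) (A0 w) t = clockwork (u w') (A0 w) t.
    by elim: t => // t IH; rewrite !clockworkS IH !clock_stepE brE.
  by move=> [t [t1 pne]]; exists t; split=> // j; rewrite -cE -brE; exact: pne.
have -> : [set w | converges (u w) (A0 w)] =
    \bigcup_(z in [set z | exists2 w, converges (u w) (A0 w) & code w = z])
      (code @^-1` [set z]).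
  apply/seteqP; split => w /=; first by move=> cw; exists (code w) => //; exists w.
  by move=> [_ [w' cw' <-] /= E]; exact: code_conv cw'.
apply: fin_bigcup_measurable => // -[a b] _.
have -> : code @^-1` [set (a, b)] = A0 @^-1` [set a] `&`
    \bigcap_(kl in [set: K * K]) [set w | (V kl.1 w <= V kl.2 w) = b kl].
  apply/seteqP; split => w /=; first by case=> <- <-; split => // kl _ /=; rewrite ffunE.
  by case=> <- H; congr (_, _); apply/ffunP => kl; rewrite ffunE; exact: H.
apply: measurableI => //; apply: fin_bigcap_measurable => // -[k l] _.
have := measurable_fun_ler (mV k) (mV l) measurableT (Y := [set b (k, l)]) I.
by rewrite setTI.
Qed.

Lemma prob_converges (i : 'I_n.+1) c : (forall j, (m j <= m i)%N) ->
  c%:R * (m i)%:R <= \prod_l (m l)%:R :> R ->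
  (P [set w | converges (u w) (A0 w)] <=
   ((c.*2.+1 * n.+1)%:R * ((m i)%:R / \prod_l (m l)%:R) +
    (1 - c%:R * (m i)%:R / \prod_l (m l)%:R) ^+ c)%:E)%E.
Proof.
move=> m_le c_le; rewrite -measurable_mu_extE; last exact: measurable_converges.
exact: mu_ext_converges.
Qed.

End Transfer.

(** * Choice of the number of rounds *)

(** Makes the number of players small against [q], which is at least [2 ^ n]; equality holds at
    [n = 3]. *)
Lemma expn2_cube n : (n.+1 ^ 3 <= 8 * 2 ^ n)%N.
Proof.
have step x : (6 <= x)%N -> (x.+1 ^ 3 <= 2 * x ^ 3)%N.
  by move=> x6; rewrite !expnS expn0 !muln1; nia.
do 5 (case: n => [//|n]); elim: n => // n IH.
rewrite [(2 ^ n.+1.+4.+1)%N]expnS mulnCA.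
by apply: (leq_trans (step _ _)) => //; rewrite leq_mul2l IH.
Qed.

(** Bernoulli's inequality for [1 + x], together with [(1 - x) * (1 + x) <= 1]. *)
Lemma exprB_le_inv (R : realFieldType) (x : R) c : 0 <= x <= 1 ->
  (1 - x) ^+ c * (1 + c%:R * x) <= 1.
Proof.
move=> /andP[x0 x1].
have bern : 1 + c%:R * x <= (1 + x) ^+ c.
  elim: c => [|c IH]; first by rewrite mul0r addr0 expr0.
  rewrite exprS -natr1; apply: le_trans (ler_wpM2l _ IH); last by rewrite addr_ge0.
  have : 0 <= c%:R * x * x by rewrite !mulr_ge0 ?ler0n.
  by lra.
apply: (@le_trans _ _ ((1 - x) ^+ c * (1 + x) ^+ c)).
  by rewrite ler_wpM2l // exprn_ge0 // subr_ge0.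
rewrite -exprMn exprn_ile1 //; nra.
Qed.

(* With [c] rounds, [c] of order [q / (k N)], both error terms are of order [1 / k]. *)
Lemma error_small (R : realType) (k N q : nat) : (0 < k)%N -> (0 < N)%N ->
  (N ^ 3 <= 8 * q)%N -> (4096 * k ^ 9 <= q)%N ->
  let c := (q %/ (k * N))%N in
  [/\ (c <= q)%N, (c.*2.+1 * N)%:R * q%:R^-1 <= 3 / k%:R :> R &
      (1 - c%:R / q%:R) ^+ c <= k%:R^-1 :> R].
Proof.
move=> k0 N0 N3 kq c.
have q0 : (0 < q)%N by apply: leq_trans kq; rewrite muln_gt0 expn_gt0 k0.
have k1 : (1 <= k ^ 3)%N by rewrite expn_gt0 k0.
have kq' : (4096 * (k ^ 3 * k ^ 3 * k ^ 3) <= q)%N by rewrite -!expnD.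
have kN_le : (k * N <= q)%N.
  rewrite -(@leq_exp2r _ _ 3) // expnMn.
  apply: (@leq_trans (k ^ 3 * (8 * q))); first by rewrite leq_mul2l N3 orbT.
  rewrite (_ : q ^ 3 = q * q * q)%N; last by rewrite !expnS expn0 muln1 mulnA.
  rewrite mulnA leq_mul2r; apply/orP; right.
  apply: (@leq_trans q); last by rewrite leq_pmulr.
  apply: leq_trans kq'; rewrite mulnC leq_mul //.
  by rewrite -mulnA leq_pmulr // muln_gt0 k1.
have c_gt0 : (0 < c)%N by rewrite divn_gt0 // muln_gt0 k0.
have c_le : (c * (k * N) <= q)%N by exact: leq_trunc_div.
have c_ge : (q <= 2 * c * (k * N))%N.
  have : (q < c.+1 * (k * N))%N by rewrite ltn_ceil // muln_gt0 k0.
  by nia.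
(* Cubing and using [N ^ 3 <= 8 * q] twice turns this into [4096 * k ^ 9 <= q], the source of that
   threshold. *)
have k3N2 : (4 * k ^ 3 * N ^ 2 <= q)%N.
  rewrite -(@leq_exp2r _ _ 3) //.
  have -> : ((4 * k ^ 3 * N ^ 2) ^ 3 = 4 ^ 3 * k ^ (3 * 3) * (N ^ 3 * N ^ 3))%N by ring.
  rewrite (_ : q ^ 3 = q * q * q)%N; last by rewrite !expnS expn0 muln1 mulnA.
  apply: (@leq_trans (4 ^ 3 * k ^ (3 * 3) * ((8 * q) * (8 * q)))).
    by rewrite leq_mul2l leq_mul ?orbT.
  have -> : (4 ^ 3 * k ^ (3 * 3) * (8 * q * (8 * q)) = 4096 * k ^ 9 * (q * q))%N.
    by rewrite (_ : 4 ^ 3 = 64)%N //; lia.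
  by rewrite mulnC leq_mul2l kq orbT.
(* This makes [c^2 / q] at least [k], as the birthday term requires. *)
have cc : (k * q <= c * c)%N.
  have kN_gt0 : (0 < 4 * (k * N) * (k * N))%N by rewrite !muln_gt0 k0 N0.
  rewrite -(leq_pmul2l kN_gt0); apply: (@leq_trans (q * q)); last first.
    by apply: leq_trans (leq_mul c_ge c_ge) _; apply: eq_leq; ring.
  have -> : (4 * (k * N) * (k * N) * (k * q) = 4 * k ^ 3 * N ^ 2 * q)%N.
    by rewrite !expnS !expn0 !muln1; ring.
  by rewrite leq_mul2r k3N2 orbT.
have cq : (c <= q)%N by apply: leq_trans c_le; rewrite leq_pmulr // muln_gt0 k0.
have qR : 0 < q%:R :> R by rewrite ltr0n.
have kR : 0 < k%:R :> R by rewrite ltr0n.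
split => //.
  (* As [c >= 1], [2c + 1 <= 3c], and [c * (k * N) <= q]. *)
  rewrite ler_pdivrMr // mulrAC ler_pdivlMr // -!natrM ler_nat; nia.
have x01 : 0 <= (c%:R / q%:R : R) <= 1.
  by rewrite divr_ge0 ?ler0n //= ler_pdivrMr // mul1r ler_nat.
have := exprB_le_inv c x01.
set y := (1 - _) ^+ c => ypow.
have y0 : 0 <= y by rewrite exprn_ge0 // subr_ge0; case/andP: x01.
rewrite -[leRHS]mul1r ler_pdivlMr //; apply: le_trans ypow; rewrite ler_wpM2l //.
have : k%:R <= c%:R * (c%:R / q%:R) :> R.
  by rewrite mulrA ler_pdivlMr // -!natrM ler_nat.
by lra.
Qed.

Theorem theorem1 (R : realType) (mu : probability R R)
  (mu_atomless : forall x : R, mu [set x] = 0%E) :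
  forall eps : R, 0 < eps ->
  exists Q : R,
  forall (n : nat) (m : 'I_n -> nat),
  (2 <= n)%N -> (forall i, (2 <= m i)%N) -> Q <= qnm R m ->
  forall (d : measure_display) (T : measurableType d) (P : probability T R)
    (U : 'I_n -> profile m -> T -> R) (A0 : T -> profile m),
  (* payoffs are random variables, each with law mu *)
  (forall i a, measurable_fun setT (U i a)) ->
  (forall i a (B : set R), measurable B -> P (U i a @^-1` B) = mu B) ->
  (* the initial profile is a uniform random profile *)
  (forall a, measurable (A0 @^-1` [set a])) ->
  (forall a, P (A0 @^-1` [set a]) = (#|profile m|%:R^-1)%:E) ->
  (* mutual independence of A0 and all the payoffs U i a *)
  (forall (S : set (profile m)) (B : 'I_n -> profile m -> set R),
     (forall i a, measurable (B i a)) ->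
     P (A0 @^-1` S `&` [set w | forall i a, B i a (U i a w)]) =
     (P (A0 @^-1` S) * \prod_(i < n) \prod_(a : profile m) P (U i a @^-1` B i a))%E) ->
  (P [set w | converges (fun i a => U i a w) (A0 w)] < eps%:E)%E.
Proof.
(* The two error terms will add up to [3 / k + 1 / k]. *)
move=> eps eps0; pose k := Num.bound (4 / eps).
have k_gt : 4 / eps < k%:R by apply: archi_boundP; rewrite divr_ge0 ?ltW.
have k0 : (0 < k)%N.
  by rewrite -(ltr0n R) (lt_trans _ k_gt) // divr_gt0.
exists (4096 * k ^ 9)%:R => -[//|n] m _ m2 Qq d T P U A0 mU lawU mA0 lawA0 indep.
have m_gt0 j : (0 < m j)%N by exact: ltnW.
(* A player [i] with the most actions; the product [q] of the other action counts is then [qnm]. *)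
have [|i mi] := @bigop.eq_bigmax _ m; first by rewrite card_ord.
have m_le j : (m j <= m i)%N by rewrite -mi bigop.leq_bigmax.
pose q := (\prod_(j < n.+1 | j != i) m j)%N.
have miR : (m i)%:R != 0 :> R by rewrite pnatr_eq0 -lt0n.
have prodE : \prod_l (m l)%:R = (m i)%:R * q%:R :> R.
  by rewrite (bigD1 i) //= -natr_prod.
have kq : (4096 * k ^ 9 <= q)%N.
  by move: Qq; rewrite /qnm prodE mi mulrAC divff // mul1r ler_nat.
have N3 : (n.+1 ^ 3 <= 8 * q)%N.
  apply: (leq_trans (expn2_cube n)); rewrite leq_mul2l /=.
  have -> : (2 ^ n = \prod_(j < n.+1 | j != i) 2)%N.
    by rewrite prod_nat_const cardC1 card_ord.
  exact: leq_prod.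
have q0 : (0 < q)%N by exact: prodn_gt0.
have qR : q%:R != 0 :> R by rewrite pnatr_eq0 -lt0n.
have [c_le e1 e2] := error_small R k0 (ltn0Sn n) N3 kq.
set c := (q %/ _)%N in c_le e1 e2.
have c_leR : c%:R * (m i)%:R <= \prod_l (m l)%:R :> R.
  by rewrite prodE mulrC ler_wpM2l ?ler0n // ler_nat.
have := prob_converges mu_atomless m_gt0 mU lawU mA0 lawA0 indep m_le c_leR.
have -> : (m i)%:R / \prod_l (m l)%:R = q%:R^-1 :> R.
  by rewrite prodE invfM mulrA divff // mul1r.
have -> : c%:R * (m i)%:R / \prod_l (m l)%:R = c%:R / q%:R :> R.
  by rewrite prodE -mulrA; congr (_ * _); rewrite invfM mulrA divff // mul1r.
move=> /le_lt_trans; apply; rewrite lte_fin; apply: (le_lt_trans (lerD e1 e2)).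
have -> : 3 / k%:R + k%:R^-1 = 4 / k%:R :> R by lra.
rewrite ltr_pdivrMr ?ltr0n //.
move: k_gt; rewrite ltr_pdivrMr // mulrC; lra.
Qed.
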